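(* Let $\mathcal{S}=\{S_d:\mathcal{H}_d\to\mathcal{G}_d\}_{d\in\mathbb{N}}$ be a sequence of compact linear operators between Hilbert spaces, with eigenvalues $\lambda_{d,1}\ge\lambda_{d,2}\ge\cdots\ge 0$ of $S_d^*S_d$. Fix an error criterion, ABS or NOR, and let $\mathrm{CRI}_d=1$ for ABS and $\mathrm{CRI}_d=\lambda_{d,1}$ for NOR. Then $\mathcal{S}$ is EXP-QPT-ABS/NOR (for the chosen criterion) iff there exists $\tau>0$ such that $$(\ast)\qquad M:=\sup_{d\in\mathbb{N}}\ d^{-\tau}\sum_{j=1}^\infty\left[1+\tfrac12\ln\max\left(1,\frac{\mathrm{CRI}_d}{\lambda_{d,j}}\right)\right]^{-\tau(1+\ln d)}<\infty .$$ If $(\ast)$ holds for some $\tau>0$, then for all $\varepsilon>0$ and $d\in\mathbb{N}$ $$n_{\mathrm{ABS}/\mathrm{NOR}}(\varepsilon,S_d)\le 1+M\,d^{\tau}+M\,d^{\tau}\left[\max(0,1+\ln\varepsilon^{-1})\right]^{\tau(1+\ln d)},$$ and the exponent of EXP-QPT-ABS/NOR is $$p^*=\inf\{\tau>0:\ \tau\text{ satisfies }(\ast)\}.$$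
   Context: Setting. $\mathbb{N}=\{1,2,\dots\}$, $\mathbb{N}_0=\mathbb{N}\cup\{0\}$. For each $d\in\mathbb{N}$, $\mathcal{H}_d$ and $\mathcal{G}_d$ are Hilbert spaces and $S_d:\mathcal{H}_d\to\mathcal{G}_d$ is a compact linear operator; $\mathcal{S}=\{S_d\}_{d\in\mathbb{N}}$. The operator $W_d=S_d^*S_d$ is compact, self-adjoint and positive semi-definite; $\lambda_{d,1}\ge\lambda_{d,2}\ge\cdots$ denote its eigenvalues in non-increasing order, counted with multiplicity (the positive ones are listed; if there are only finitely many, the sequence is continued by zeros). For the criterion NOR it is assumed that $S_d\neq0$, i.e. $\lambda_{d,1}=\|S_d\|^2>0$. Convention: if $\lambda_{d,j}=0$, then $\mathrm{CRI}_d/\lambda_{d,j}=\infty$, $\ln\infty=\infty$, and $\infty^{-x}=0$ for $x>0$ (such $j$ contribute $0$ to the sum). Information complexity. An algorithm $A_{d,n}:\mathcal{H}_d\to\mathcal{G}_d$ has $A_{d,0}=0$, and for $n\ge1$ has the form $A_{d,n}(f)=\phi_n(L_1(f),\dots,L_n(f))$ with an arbitrary map $\phi_n:\mathbb{C}^n\to\mathcal{G}_d$ and continuous linear functionals $L_j$ on $\mathcal{H}_d$, possibly chosen adaptively ($L_j$ may depend on $L_1(f),\dots,L_{j-1}(f)$). Its worst case error is $e(A_{d,n})=\sup_{\|f\|_{\mathcal{H}_d}\le1}\|S_d(f)-A_{d,n}(f)\|_{\mathcal{G}_d}$, and $e(n,S_d)=\inf_{A_{d,n}}e(A_{d,n})$.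 For $\varepsilon>0$, $n_{\mathrm{ABS}}(\varepsilon,S_d)=\min\{n\in\mathbb{N}_0: e(n,S_d)\le\varepsilon\}$ (absolute error criterion, ABS) and $n_{\mathrm{NOR}}(\varepsilon,S_d)=\min\{n\in\mathbb{N}_0: e(n,S_d)\le\varepsilon\|S_d\|\}$ (normalized error criterion, NOR). It is a known fact that $n_{\mathrm{ABS}}(\varepsilon,S_d)=\min\{n\in\mathbb{N}_0:\lambda_{d,n+1}\le\varepsilon^2\}$ and $n_{\mathrm{NOR}}(\varepsilon,S_d)=\min\{n\in\mathbb{N}_0:\lambda_{d,n+1}\le\varepsilon^2\lambda_{d,1}\}$; these formulas may be taken as the definition. Tractability notion (for ABS or NOR). EXP-QPT-ABS/NOR (quasi-polynomial tractability, exponential case): there are $C,p\ge0$ such that for all $d\in\mathbb{N}$, $\varepsilon>0$, $$n_{\mathrm{ABS}/\mathrm{NOR}}(\varepsilon,S_d)\le C\exp\left(p\,(1+\ln d)\,(1+\ln(1+\ln\max(1,\varepsilon^{-1})))\right).$$ The infimum of all $p$ for which such a bound holds (with some $C$) is the exponent $p^*$ of EXP-QPT-ABS/NOR. *)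

(* Defs.v *)
From HB Require Import structures.
From mathcomp Require Import all_boot all_order all_algebra.
From mathcomp Require Import complex.
From mathcomp Require Import all_classical all_reals all_analysis.

Set Implicit Arguments.
Unset Strict Implicit.
Unset Printing Implicit Defensive.

Import Order.TTheory GRing.Theory Num.Theory.
Import numFieldNormedType.Exports.

Local Open Scope classical_set_scope.
Local Open Scope ring_scope.
Local Open Scope complex_scope.

(* Complex Hilbert spaces: Banach spaces over R[i] whose norm comes from an
   inner product, linear in its first argument. *)
HB.mixin Record CompleteNormedModule_isHilbert (R : realType) H
    of CompleteNormedModule R[i] H := {
  inner : H -> H -> R[i] ;
  innerDZl : forall (a : R[i]) (x y z : H),
    inner (a *: x + y) z = a * inner x z + inner y z ;
  innerC : forall x y : H, inner y x = (inner x y)^* ;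
  norm_inner : forall x : H, `|x| ^+ 2 = inner x x }.

#[short(type="hilbertType")]
HB.structure Definition Hilbert (R : realType) :=
  {H of CompleteNormedModule_isHilbert R H & CompleteNormedModule R[i] H}.

Section Operators.
Variables (R : realType) (H G : hilbertType R).

Definition compact_operator (S : H -> G) : Prop :=
  precompact (S @` [set x : H | `|x| <= 1]).

(* The Hilbert adjoint: [adjoint S y] is the vector z with <S x, y> = <x, z>
   for all x, which exists and is unique (Riesz) when S is linear and
   bounded. *)
Definition adjoint (S : H -> G) (y : G) : H :=
  xget 0 [set z | forall x, inner (S x) y = inner x z].

End Operators.

Section Eigenvalues.
Variables (R : realType) (H : hilbertType R).

Definition eigenvectors (W : H -> H) (t : R) : set H :=
  [set x | W x = t%:C *: x].

Definition has_dim (V : set H) (n : nat) : Prop :=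
  exists b : 'I_n -> H,
    [/\ forall i, V (b i),
        forall c : 'I_n -> R[i],
          \sum_(i < n) c i *: b i = 0 -> forall i, c i = 0
      & forall x, V x -> exists c : 'I_n -> R[i], x = \sum_(i < n) c i *: b i].

(* [lam 0 >= lam 1 >= ...] lists the positive eigenvalues of W: each t > 0
   occurs exactly as often as the dimension of its eigenspace (0 if t is not an
   eigenvalue). The remaining entries, if any, are zeros. Indices start at 0:
   [lam j] is the (j+1)-st eigenvalue. *)
Definition eigenvalue_sequence (W : H -> H) (lam : nat -> R) : Prop :=
  [/\ {homo lam : i j / (i <= j)%N >-> j <= i},
      forall j, 0 <= lam j
    & forall t : R, 0 < t ->
        exists n : nat, has_dim (eigenvectors W t) n /\
                        ([set j | lam j = t] #= `I_n)%card].

End Eigenvalues.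

Variant criterion := ABS | NOR.

(* Below, [lam d] is the eigenvalue sequence of S_d^* S_d, for d >= 1; the value
   at d = 0 is never used. *)
Section Tractability.
Variables (R : realType) (crit : criterion) (lam : nat -> nat -> R).

Definition CRI (d : nat) : R :=
  match crit with ABS => 1 | NOR => lam d 0%N end.

(* The minimum over n >= 0 of { n | lambda_{d,n+1} <= eps^2 CRI_d }, as an
   extended real; +oo would stand for the minimum of the empty set, but the
   set is never empty, since the eigenvalues of a compact operator tend
   to 0. *)
Definition info_complexity (eps : R) (d : nat) : \bar R :=
  ereal_inf [set n%:R%:E | n in [set n : nat | lam d n <= eps ^+ 2 * CRI d]].

Definition EXP_QPT_bound (C p : R) : Prop :=
  forall (d : nat) (eps : R), (0 < d)%N -> 0 < eps ->
    (info_complexity eps d <=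
     (C * expR (p * (1 + ln d%:R)
                  * (1 + ln (1 + ln (Num.max 1 eps^-1)))))%:E)%E.

Definition EXP_QPT : Prop :=
  exists C p : R, [/\ 0 <= C, 0 <= p & EXP_QPT_bound C p].

Definition EXP_QPT_exponent : \bar R :=
  ereal_inf [set p%:E | p in
    [set p : R | 0 <= p /\ exists C : R, 0 <= C /\ EXP_QPT_bound C p]].

Definition summand (tau : R) (d j : nat) : R :=
  if lam d j == 0 then 0
  else (1 + 2^-1 * ln (Num.max 1 (CRI d / lam d j)))
         `^ (- (tau * (1 + ln d%:R))).

Definition M (tau : R) : \bar R :=
  ereal_sup [set ((d%:R `^ (- tau))%:E *
                  \sum_(0 <= j <oo) (summand tau d j)%:E)%E
            | d in [set d : nat | (0 < d)%N]].

End Tractability.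

(* Main.v *)
(** Write [L d j] for the bracket [1 + ln (max 1 (CRI_d / lambda_{d,j})) / 2].
    Since the summands are non-increasing in [j], the term of index [j] is at
    most [M d^tau / j]; reading this at the last [j] with
    [lambda_{d,j} > eps^2 CRI_d] bounds the complexity, hence gives EXP-QPT with
    [p = tau].  Conversely an EXP-QPT bound with exponent [p > 0], read at levels
    [eps] just below [sqrt (lambda_{d,j} / CRI_d)], yields
    [j <= C e (e d)^p (L d j)^(p (1 + ln d))]; raising this to the power
    [- tau / p] with [tau > p] dominates the sum by
    [(C e)^(tau/p) (e d)^tau zeta(tau/p)]. *)

Require Import Defs.
From mathcomp Require Import all_boot all_order all_algebra.
From mathcomp Require Import complex.
From mathcomp Require Import all_classical all_reals all_analysis.
From mathcomp Require Import lra.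

Set Implicit Arguments.
Unset Strict Implicit.

Import Order.TTheory GRing.Theory Num.Theory.
Import numFieldNormedType.Exports.

Local Open Scope classical_set_scope.
Local Open Scope ring_scope.

(** * Elementary estimates for logarithms, powers and the zeta series *)

Section RealFacts.
Context {R : realType}.
Implicit Types (x y r s : R) (d n : nat).

Lemma ln_max1 x : 0 < x -> ln (Num.max 1 x) = Num.max 0 (ln x).
Proof.
move=> x0; have [x1|x1] := leP x 1.
  by rewrite ln1 max_l// ln_le0.
by rewrite max_r// ln_ge0// ltW.
Qed.

Lemma le_ln_max1 {x y} : x <= y -> ln (Num.max 1 x) <= ln (Num.max 1 y).
Proof.
move=> xy; rewrite ler_ln ?posrE ?lt_max ?ltr01//.
by rewrite ge_max !le_max lexx xy orbT.
Qed.

Lemma ln_max1_ge0 x : 0 <= ln (Num.max 1 x).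
Proof. by rewrite ln_ge0// le_max lexx. Qed.

Lemma expR_mulD1 y x : 0 < x -> expR (y * (1 + ln x)) = expR y * x `^ y.
Proof. by move=> x0; rewrite mulrDr mulr1 expRD /powR gt_eqF. Qed.

(** Comparison of $x^{-(1+r)}$ with its integral over $[n+1,n+2]$, obtained without integration:
    after dividing by $(n+2)^{-r}$ it follows from $1+t\le e^t$ at $t=r\ln\frac{n+2}{n+1}$. *)
Lemma powRN_telescope n r : 0 < r ->
  n.+2%:R `^ (- (1 + r)) <= r^-1 * (n.+1%:R `^ (- r) - n.+2%:R `^ (- r)) :> R.
Proof.
move=> r0; rewrite ler_pdivlMl//.
have n1 : 0 < n.+1%:R :> R by rewrite ltr0n.
have n2 : 0 < n.+2%:R :> R by rewrite ltr0n.
have -> : n.+2%:R `^ (- (1 + r)) = n.+2%:R^-1 * n.+2%:R `^ (- r) :> R.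
  rewrite opprD powRD; last by rewrite (gt_eqF n2) implybT.
  by rewrite powR_inv1 ?ltW.
have -> : n.+1%:R `^ (- r)
    = n.+2%:R `^ (- r) * expR (r * ln (n.+2%:R / n.+1%:R)) :> R.
  rewrite /powR !gt_eqF// -expRD lnM ?posrE ?invr_gt0// lnV ?posrE//.
  by congr expR; lra.
set P := n.+2%:R `^ (- r); have P0 : 0 < P by exact: powR_gt0.
rewrite -[X in _ - X]mulr1 -mulrBr mulrA [leRHS]mulrC ler_pM2r//.
have : n.+2%:R^-1 <= ln (n.+2%:R / n.+1%:R) :> R.
  (* Writing the ratio as an inverse turns the upper bound $\ln(1+x)\le x$ at $x=-1/(n+2)$ into the
     required lower bound. *)
  have -> : n.+2%:R / n.+1%:R = (1 - n.+2%:R^-1)^-1 :> R.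
    have -> : 1 - n.+2%:R^-1 = n.+1%:R / n.+2%:R :> R.
      have -> : n.+1%:R = n.+2%:R - 1 :> R by rewrite -[n.+2%:R]natr1 addrK.
      by rewrite mulrBl mulfV ?mul1r// gt_eqF.
    by rewrite invf_div.
  have n2i : n.+2%:R^-1 < 1 :> R by rewrite invf_lt1// ltr1n.
  rewrite lnV ?posrE ?subr_gt0//.
  have := @le_ln1Dx R (- n.+2%:R^-1); rewrite ltrN2 => /(_ n2i).
  by rewrite lerNr.
move=> /(ler_wpM2l (ltW r0)) /le_trans; apply.
by rewrite lerBrDl expR_ge1Dx.
Qed.

Lemma sum_powRN_le n s : 1 < s ->
  \sum_(0 <= j < n) j.+1%:R `^ (- s) <= 1 + (s - 1)^-1 :> R.
Proof.
move=> s1; have r0 : 0 < s - 1 by rewrite subr_gt0.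
have ri : 0 < (s - 1)^-1 by rewrite invr_gt0.
case: n => [|n]; first by rewrite big_geq//; lra.
(* Subtracting the telescoping remainder makes the bound inductive; for a single term it is an
   equality. *)
suff : \sum_(0 <= j < n.+1) j.+1%:R `^ (- s)
    <= 1 + (s - 1)^-1 - (s - 1)^-1 * n.+1%:R `^ (- (s - 1)).
  move/le_trans; apply; rewrite lerBlDr lerDl.
  by rewrite mulr_ge0 ?powR_ge0// ltW.
elim: n => [|n IH].
  by rewrite big_nat1 !powR1; lra.
rewrite big_nat_recr//=; have := @powRN_telescope n _ r0.
rewrite subrKC mulrBr; lra.
Qed.

End RealFacts.

(** * Positivity and monotonicity of the summands *)

Section Sequences.
Context {R : realType} {crit : criterion} {lam : nat -> nat -> R}.
Hypothesis lam_anti :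
  forall d, (0 < d)%N -> {homo lam d : i j / (i <= j)%N >-> j <= i}.
Hypothesis lam_ge0 : forall d, (0 < d)%N -> forall j, 0 <= lam d j.
Implicit Types (tau eps C p : R) (d j n : nat).

Local Notation CRI := (CRI crit lam).
Local Notation M := (M crit lam).
Local Notation summand := (summand crit lam).
Local Notation info_complexity := (info_complexity crit lam).
Local Notation loglev d j := (1 + 2^-1 * ln (Num.max 1 (CRI d / lam d j))).
Local Notation oneln d := (1 + ln (d%:R : R)).

Lemma CRI_ge0 d : (0 < d)%N -> 0 <= CRI d.
Proof. by rewrite /Defs.CRI; case: crit => // d0; exact: lam_ge0. Qed.

Lemma CRI_gt0 d j : (0 < d)%N -> lam d j != 0 -> 0 < CRI d.
Proof.
rewrite /Defs.CRI; case: crit => // d0 lj; rewrite (@lt_le_trans _ _ (lam d j))//.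
  by rewrite lt_neqAle eq_sym lj lam_ge0.
exact: lam_anti.
Qed.

Lemma oneln_ge1 d : (0 < d)%N -> 1 <= oneln d.
Proof. by move=> d0; rewrite lerDl ln_ge0// ler1n. Qed.

Lemma loglev_ge1 d j : 1 <= loglev d j.
Proof. by rewrite lerDl mulr_ge0 ?invr_ge0// ln_max1_ge0. Qed.

Lemma summand_ge0 tau d j : 0 <= summand tau d j.
Proof. by rewrite /Defs.summand; case: ifP => // _; exact: powR_ge0. Qed.

Lemma le_summand tau d i j : (0 < d)%N -> 0 < tau -> (i <= j)%N ->
  summand tau d j <= summand tau d i.
Proof.
move=> d0 t0 ij; have [lj0|lj0] := eqVneq (lam d j) 0.
  by rewrite {1}/Defs.summand lj0 eqxx summand_ge0.
have lj : 0 < lam d j by rewrite lt_neqAle eq_sym lj0 lam_ge0.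
have lij : lam d j <= lam d i by exact: lam_anti.
have li : 0 < lam d i by exact: lt_le_trans lij.
rewrite /Defs.summand !gt_eqF// !powRN lef_pV2; last 2 first.
- by rewrite posrE powR_gt0// (lt_le_trans ltr01)// loglev_ge1.
- by rewrite posrE powR_gt0// (lt_le_trans ltr01)// loglev_ge1.
apply: ge0_ler_powR.
- by rewrite mulr_ge0 ?(ltW t0)// (le_trans ler01)// oneln_ge1.
- by rewrite nnegrE (le_trans ler01)// loglev_ge1.
- by rewrite nnegrE (le_trans ler01)// loglev_ge1.
rewrite lerD2l ler_pM2l ?invr_gt0// le_ln_max1// ler_wpM2l ?CRI_ge0//.
by rewrite lef_pV2.
Qed.

(** * From finiteness of [M] to complexity bounds *)

Lemma M_ge0 tau : (0 <= M tau)%E.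
Proof.
apply: le_ereal_sup_tmp; exists ((1%:R `^ (- tau))%:E *
  \sum_(0 <= j <oo) (summand tau 1 j)%:E)%E; first by exists 1%N.
rewrite mule_ge0 ?lee_fin ?powR_ge0// nneseries_ge0// => *.
by rewrite lee_fin summand_ge0.
Qed.

Lemma M_fin_num tau : (M tau < +oo)%E -> M tau \is a fin_num.
Proof. by move=> Moo; rewrite ge0_fin_numE ?M_ge0. Qed.

Lemma summand_le_M tau d n : (0 < d)%N -> 0 < tau -> (M tau < +oo)%E ->
  n.+1%:R * summand tau d n <= fine (M tau) * d%:R `^ tau.
Proof.
move=> d0 t0 Moo; rewrite -lee_fin [leRHS]EFinM fineK ?M_fin_num//.
have dt : 0 < d%:R `^ tau :> R by rewrite powR_gt0// ltr0n.
rewrite -lee_pdivrMr// muleC -powRN.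
have : ((d%:R `^ (- tau))%:E * \sum_(0 <= j <oo) (summand tau d j)%:E
    <= M tau)%E by apply: ereal_sup_ubound; exists d.
apply: le_trans; rewrite lee_wpmul2l ?lee_fin ?powR_ge0//.
apply: le_trans (nneseries_lim_ge n.+1 _); last first.
  by move=> *; rewrite lee_fin summand_ge0.
(* [n.+1] copies of the smallest of the first [n.+1] summands, compared term by term. *)
rewrite sumEFin lee_fin mulr_natl -[X in _ *+ X](subn0 n.+1) -sumr_const_nat.
by rewrite !big_mkord; apply: ler_sum => i _; rewrite le_summand// -ltnS.
Qed.

Lemma index_le tau eps d n : (0 < d)%N -> 0 < tau -> (M tau < +oo)%E ->
  0 < eps -> eps ^+ 2 * CRI d < lam d n ->
  n.+1%:R <= fine (M tau) * d%:R `^ tau + fine (M tau) * d%:R `^ tau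
    * (Num.max 0 (1 + ln eps^-1)) `^ (tau * oneln d).
Proof.
move=> d0 t0 Moo e0 en; have := summand_le_M n d0 t0 Moo.
set A := fine _ * _; set B := _ `^ (tau * _).
have A0 : 0 <= A by rewrite mulr_ge0 ?powR_ge0// fine_ge0// M_ge0.
have B0 : 0 <= B by exact: powR_ge0.
have c0 := CRI_ge0 d0.
have ln0 : 0 < lam d n.
  by apply: le_lt_trans en; rewrite mulr_ge0// exprn_ge0// ltW.
have AB : 0 <= A * B by rewrite mulr_ge0.
(* For [eps >= 1] the eigenvalue exceeds [CRI d], so the summand is 1 and the first term [A]
   suffices; for [eps < 1] the bound comes from [A * B]. *)
rewrite /Defs.summand gt_eqF//; have [e1|e1] := leP 1 eps.
  rewrite max_l; last first.
    rewrite ler_pdivrMr// mul1r (le_trans _ (ltW en))// ler_peMl//.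
    by rewrite exprn_ege1.
  by rewrite ln1 mulr0 addr0 powR1 mulr1; lra.
have le0 : 0 <= ln eps^-1 by rewrite ln_ge0// invf_ge1// ltW.
have q0 : 0 <= tau * oneln d.
  by rewrite mulr_ge0 ?(ltW t0)// (le_trans ler01)// oneln_ge1.
have : loglev d n `^ (tau * oneln d) <= B.
  apply: ge0_ler_powR => //.
  - by rewrite nnegrE (le_trans ler01)// loglev_ge1.
  - by rewrite nnegrE le_max lexx.
  rewrite [Num.max 0 _]max_r; last by rewrite addr_ge0.
  rewrite lerD2l ler_pdivrMl// mulr_natl -lnXn ?invr_gt0//.
  have -> : eps^-1 ^+ 2 = Num.max 1 (eps^-1 ^+ 2).
    by rewrite max_r// exprn_ege1// invf_ge1// ltW.
  apply: le_ln_max1; rewrite ler_pdivrMr// exprVn ler_pdivlMl ?exprn_gt0//.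
  exact: ltW.
move=> LB; rewrite powRN ler_pdivrMr; last first.
  by rewrite powR_gt0// (lt_le_trans ltr01)// loglev_ge1.
by move=> /le_trans; apply; have := ler_wpM2l A0 LB; lra.
Qed.

Lemma info_complexity_le tau eps d : 0 < tau -> (M tau < +oo)%E ->
  0 < eps -> (0 < d)%N ->
  (info_complexity eps d <=
     1 + M tau * (d%:R `^ tau)%:E
       + M tau * (d%:R `^ tau)%:E
         * ((Num.max 0 (1 + ln eps^-1)) `^ (tau * oneln d))%:E)%E.
Proof.
move=> t0 Moo e0 d0; rewrite -(fineK (M_fin_num Moo)) -!EFinM -!EFinD.
have idx n := @index_le tau eps d n d0 t0 Moo e0.
set A := fine _ * _ in idx *; set B := _ `^ (tau * _) in idx *.
have A0 : 0 <= A by rewrite mulr_ge0 ?powR_ge0// fine_ge0// M_ge0.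
have B0 : 0 <= B by exact: powR_ge0.
have AB : 0 <= A * B by rewrite mulr_ge0.
have [ex|nex] := pselect (exists n, lam d n <= eps ^+ 2 * CRI d); last first.
  (* If every eigenvalue exceeded the threshold, [idx] would bound all natural numbers by
     [A + A * B]. *)
  have := idx (Num.truncn (A + A * B)); rewrite ltNge.
  case: leP => [le|_ /(_ isT)]; first by case: nex; exists (Num.truncn (A + A * B)).
  by rewrite leNgt truncnS_gt.
case: (ex_minnP ex) => n nP nmin.
apply: (@le_trans _ _ n%:R%:E); first by apply: ereal_inf_lbound; exists n.
(* The predecessor of a positive minimum still violates the threshold, so [idx] applies to it and
   bounds the minimum itself. *)
rewrite lee_fin; case: n nP nmin => [|n] nP nmin; first by lra.
have := idx n; rewrite ltNge; case: leP => [/nmin|_ /(_ isT)]; last by lra.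
by rewrite ltnn.
Qed.

(** With $L=1+\ln\max(1,\varepsilon^{-1})$ the target exponential factors as $e^\tau d^\tau
    L^{\tau(1+\ln d)}$, all factors being at least 1. The three terms of the complexity bound are at
    most 1, $M$ and $M$ times it, hence the constant $1+2M$. *)
Lemma M_EXP_QPT_bound tau : 0 < tau -> (M tau < +oo)%E ->
  EXP_QPT_bound crit lam (1 + 2 * fine (M tau)) tau.
Proof.
move=> t0 Moo d eps d0 e0.
apply: (le_trans (info_complexity_le t0 Moo e0 d0)).
rewrite -(fineK (M_fin_num Moo)) -!EFinM -!EFinD lee_fin /=.
have m0 : 0 <= fine (M tau) by rewrite fine_ge0// M_ge0.
set m := fine _ in m0 *.
have L1 : 1 <= 1 + ln (Num.max 1 eps^-1) by rewrite lerDl ln_max1_ge0.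
have q0 : 0 <= tau * oneln d.
  by rewrite mulr_ge0 ?(ltW t0)// (le_trans ler01)// oneln_ge1.
rewrite expR_mulD1 ?(lt_le_trans ltr01)// expR_mulD1 ?ltr0n//.
have : (Num.max 0 (1 + ln eps^-1)) `^ (tau * oneln d)
    <= (1 + ln (Num.max 1 eps^-1)) `^ (tau * oneln d).
  apply: ge0_ler_powR => //.
  - by rewrite nnegrE le_max lexx.
  - by rewrite nnegrE (le_trans ler01).
  rewrite ge_max (le_trans ler01)//= lerD2l ln_max1 ?invr_gt0//.
  by rewrite le_max lexx orbT.
set B := _ `^ _; set B' := _ `^ _ => BB'.
have B'1 : 1 <= B' by rewrite -(powRr0 (1 + ln (Num.max 1 eps^-1))) ler_powR.
set D := d%:R `^ tau.
have D1 : 1 <= D by rewrite -(powRr0 (d%:R : R)) ler_powR ?(ltW t0)// ler1n.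
have E1 : 1 <= expR tau by rewrite -expR0 ler_expR ltW.
have D0 : 0 <= D by lra.
have DB : D <= D * B' by rewrite ler_peMr.
have DBB : D * B <= D * B' by rewrite ler_wpM2l.
have EDB : D * B' <= expR tau * (D * B') by rewrite ler_peMl//; lra.
rewrite -!mulrA.
apply: (@le_trans _ _ ((1 + 2 * m) * (D * B'))); last first.
  by rewrite ler_wpM2l//; lra.
have := ler_wpM2l m0 DB; have := ler_wpM2l m0 DBB; lra.
Qed.

(** * From a complexity bound to finiteness of [M] *)

Lemma EXP_QPT_bound_index C p eps d n : EXP_QPT_bound crit lam C p ->
  (0 < d)%N -> 0 < eps -> eps ^+ 2 * CRI d < lam d n ->
  n.+1%:R <= C * expR (p * oneln d * (1 + ln (1 + ln (Num.max 1 eps^-1)))).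
Proof.
move=> bnd d0 e0 en; rewrite -lee_fin; apply: le_trans (bnd d eps d0 e0).
(* By monotonicity an admissible [k <= n] would make [n] admissible too, so the minimum is at least
   [n.+1]. *)
apply: le_ereal_inf_tmp => _ [k /= kP <-]; rewrite lee_fin ler_nat ltnNge.
apply/negP => kn; have := le_lt_trans kP en.
by rewrite ltNge lam_anti.
Qed.

(* The level [eps] is taken slightly below [sqrt (lam d n / CRI d)], by a factor
   [expR (- delta)] with [delta = 1 / (p (1 + ln d))]: then passing from [eps]
   to the limit level costs only the factor [e], uniformly in [d]. *)
Lemma EXP_QPT_bound_ln_index C p d n : EXP_QPT_bound crit lam C p -> 0 < C ->
  0 < p -> (0 < d)%N -> lam d n != 0 ->
  ln n.+1%:R <= ln C + 1 + p * oneln d * (1 + ln (loglev d n)).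
Proof.
move=> bnd C0 p0 d0 ln0.
have c0 := CRI_gt0 d0 ln0.
have {}ln0 : 0 < lam d n by rewrite lt_neqAle eq_sym ln0 lam_ge0.
have o1 := oneln_ge1 d0; have a0 : 0 < p * oneln d by rewrite mulr_gt0//; lra.
set delta := (p * oneln d)^-1.
have del0 : 0 < delta by rewrite invr_gt0.
set mu := lam d n / CRI d.
have mu0 : 0 < mu by rewrite divr_gt0.
pose eps := expR (2^-1 * ln mu - delta).
have := @EXP_QPT_bound_index C p eps d n bnd d0 (expR_gt0 _).
have -> : eps ^+ 2 * CRI d < lam d n.
  rewrite -ltr_pdivlMr// -/mu -expRM_natl -[ltRHS]lnK ?posrE// ltr_expR.
  by lra.
move=> /(_ isT) bn.
have L1 := loglev_ge1 d n.
have : ln (1 + ln (Num.max 1 eps^-1)) <= ln (loglev d n) + delta.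
  (* Since the bracket is at least 1, the additive error [delta] is absorbed into the factor
     [1 + delta], whose logarithm is at most [delta]. *)
  apply: (@le_trans _ _ (ln (loglev d n * (1 + delta)))); last first.
    rewrite lnM ?posrE; [|lra|lra].
    by rewrite lerD2l le_ln1Dx//; lra.
  rewrite ler_ln ?posrE; last 2 first.
  - by rewrite ltr_pwDl// ln_max1_ge0.
  - by rewrite mulr_gt0; lra.
  have -> : loglev d n * (1 + delta) = loglev d n + loglev d n * delta by lra.
  have : delta <= loglev d n * delta by rewrite ler_peMl// ltW.
  rewrite !ln_max1 ?invr_gt0 ?expR_gt0 ?divr_gt0// -expRN expRK.
  have -> : ln (CRI d / lam d n) = - ln mu.
    by rewrite -lnV ?posrE// invf_div.
  by case: (leP 0 (- ln mu)); case: (leP 0 (- (2^-1 * ln mu - delta))); lra.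
move=> /(ler_wpM2l (ltW a0)); rewrite [leRHS]mulrDr mulfV ?gt_eqF// => Lle.
have : ln n.+1%:R <= ln (C * expR (p * oneln d *
    (1 + ln (1 + ln (Num.max 1 eps^-1))))).
  by rewrite ler_ln ?posrE ?ltr0n// mulr_gt0// expR_gt0.
by rewrite lnM ?posrE ?expR_gt0// expRK; lra.
Qed.

Lemma EXP_QPT_bound_summand C p tau d n : EXP_QPT_bound crit lam C p -> 0 < C ->
  0 < p -> 0 < tau -> (0 < d)%N ->
  summand tau d n <=
    expR (tau * oneln d + tau / p * (ln C + 1)) * n.+1%:R `^ (- (tau / p)).
Proof.
move=> bnd C0 p0 t0 d0; rewrite /Defs.summand; case: eqVneq => [_|ln0].
  by rewrite mulr_ge0 ?expR_ge0 ?powR_ge0.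
have s0 : 0 < tau / p by rewrite divr_gt0.
have L1 := loglev_ge1 d n.
rewrite /powR !gt_eqF ?ltr0n//; last by lra.
rewrite -expRD ler_expR.
have := EXP_QPT_bound_ln_index bnd C0 p0 d0 ln0.
(* Scaling by [tau / p] turns [p * oneln d] into [tau * oneln d], the exponent in the summand. *)
move=> /(ler_wpM2l (ltW s0)).
rewrite mulrDr !mulrA divfK ?gt_eqF//.
by lra.
Qed.

Lemma EXP_QPT_bound_M C p tau : EXP_QPT_bound crit lam C p ->
  0 < C -> 0 < p -> p < tau -> (M tau < +oo)%E.
Proof.
move=> bnd C0 p0 pt; have t0 : 0 < tau by lra.
have s1 : 1 < tau / p by rewrite ltr_pdivlMr// mul1r.
set s := tau / p in s1 *.
(* This bound is free of [d]: $e^{\tau(1+\ln d)}=e^\tau d^\tau$, and the weight $d^{-\tau}$ in [M]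
   cancels $d^\tau$. The last factor bounds $\zeta(s)$, finite because $s>1$. *)
apply: (@le_lt_trans _ _ (expR (tau + s * (ln C + 1))
  * (1 + (s - 1)^-1))%:E); last exact: ltry.
apply: ge_ereal_sup => _ [d /= d0 <-].
have dt : 0 < d%:R `^ tau :> R by rewrite powR_gt0// ltr0n.
rewrite powRN lee_pdivrMl// -EFinM; apply: lime_le.
  by apply: is_cvg_nneseries => *; rewrite lee_fin summand_ge0.
apply: nearW => n; rewrite sumEFin lee_fin.
apply: (@le_trans _ _ (expR (tau * oneln d + s * (ln C + 1))
    * \sum_(0 <= j < n) j.+1%:R `^ (- s))).
  rewrite big_distrr /=; apply: ler_sum => j _.
  exact: EXP_QPT_bound_summand.
rewrite mulrA; apply: ler_pM.
- exact: expR_ge0.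
- by apply: sumr_ge0 => *; exact: powR_ge0.
- by rewrite !expRD expR_mulD1 ?ltr0n// mulrA [_ * expR tau]mulrC.
- exact: sum_powRN_le.
Qed.

(** * The equivalence and the exponent *)

Lemma EXP_QPT_bound_weaken C p C' p' : 0 <= C -> C <= C' -> p <= p' ->
  EXP_QPT_bound crit lam C p -> EXP_QPT_bound crit lam C' p'.
Proof.
move=> C0 CC' pp' bnd d eps d0 e0; apply: (le_trans (bnd d eps d0 e0)).
rewrite lee_fin ler_pM ?expR_ge0// ler_expR -!mulrA ler_wpM2r//.
rewrite mulr_ge0 ?(le_trans ler01 (oneln_ge1 d0))//.
by rewrite addr_ge0// ln_ge0// lerDl ln_max1_ge0.
Qed.

(** Covers the degenerate cases [C = 0] and [p = 0]: the constant is raised to [C + 1] and the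
    exponent to the midpoint of [p] and [tau], which is positive and still below [tau]. *)
Lemma EXP_QPT_bound_lt_M C p tau : 0 <= C -> 0 <= p ->
  EXP_QPT_bound crit lam C p -> p < tau -> (M tau < +oo)%E.
Proof.
move=> C0 p0 bnd pt.
apply: (@EXP_QPT_bound_M (C + 1) ((p + tau) / 2)); [|lra|lra|lra].
by apply: EXP_QPT_bound_weaken bnd => //; lra.
Qed.

Lemma EXP_QPTP :
  EXP_QPT crit lam <-> exists tau, 0 < tau /\ (M tau < +oo)%E.
Proof.
split=> [[C [p [C0 p0 bnd]]]|[tau [t0 Moo]]].
  by exists (p + 1); split; [lra|apply: (EXP_QPT_bound_lt_M C0 p0 bnd); lra].
exists (1 + 2 * fine (M tau)), tau; split; [|exact: ltW|].
  by rewrite addr_ge0// mulr_ge0// fine_ge0// M_ge0.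
exact: M_EXP_QPT_bound.
Qed.

(** Every [t] with [M t] finite is an admissible exponent. Conversely an admissible [p] need not
    have [M p] shown finite, but [p + e] does for each [e > 0], which leaves the infimum
    unchanged. *)
Lemma EXP_QPT_exponentE : EXP_QPT_exponent crit lam =
  ereal_inf [set t%:E | t in [set t : R | 0 < t /\ (M t < +oo)%E]].
Proof.
apply/eqP; rewrite eq_le; apply/andP; split.
  apply: le_ereal_inf => _ [t [t0 Moo] <-]; exists t => //; split.
    exact: ltW.
  exists (1 + 2 * fine (M t)); split; last exact: M_EXP_QPT_bound.
  by rewrite addr_ge0// mulr_ge0// fine_ge0// M_ge0.
apply: le_ereal_inf_tmp => _ [p [p0 [C [C0 bnd]]] <-].
apply/lee_addgt0Pr => e e0; rewrite -EFinD.
apply: ereal_inf_lbound; exists (p + e) => //; split; first by lra.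
by apply: (EXP_QPT_bound_lt_M C0 p0 bnd); lra.
Qed.

End Sequences.

Theorem theorem2 (R : realType) (H G : nat -> hilbertType R)
    (S : forall d : nat, {linear H d -> G d})
    (lam : nat -> nat -> R) (crit : criterion)
    (compactS : forall d : nat, (0 < d)%N -> compact_operator (S d))
    (eigenS : forall d : nat, (0 < d)%N ->
       eigenvalue_sequence (adjoint (S d) \o S d) (lam d))
    (nonzeroS : crit = NOR -> forall d : nat, (0 < d)%N ->
       exists f : H d, S d f <> 0) :
  (EXP_QPT crit lam <->
     exists tau : R, 0 < tau /\ (M crit lam tau < +oo)%E)
  /\
  (forall tau : R, 0 < tau -> (M crit lam tau < +oo)%E ->
     (forall (eps : R) (d : nat), 0 < eps -> (0 < d)%N ->
        (info_complexity crit lam eps d <=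
         1 + M crit lam tau * (d%:R `^ tau)%:E
           + M crit lam tau * (d%:R `^ tau)%:E
             * ((Num.max 0 (1 + ln eps^-1)) `^ (tau * (1 + ln d%:R)))%:E)%E)
     /\
     EXP_QPT_exponent crit lam =
       ereal_inf [set t%:E | t in
         [set t : R | 0 < t /\ (M crit lam t < +oo)%E]]).
Proof.
have anti d : (0 < d)%N -> {homo lam d : i j / (i <= j)%N >-> j <= i}.
  by move=> /eigenS[].
have ge0 d : (0 < d)%N -> forall j, 0 <= lam d j by move=> /eigenS[].
split; first exact: EXP_QPTP.
move=> tau t0 Moo; split; last exact: EXP_QPT_exponentE.
by move=> eps d e0 d0; exact: info_complexity_le.
Qed.
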